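(* Let $\Omega:=[0,1)^D$. For any $0<p,q\le\infty$, any $s_I>0$ and any $s>0$, the space $\mathcal F^s_q(L^p)$ is not continuously embedded in the isotropic Besov space $B^{s_I}_q(L^p(\Omega))$: $$\mathcal F^s_q(L^p)\not\hookrightarrow B^{s_I}_q(L^p(\Omega)).$$
   Context: $b\ge2$, $D\ge1$, $m\ge0$ are integers; $S=\mathbb P_m$ is the space of polynomials of degree at most $m$ restricted to $[0,1)$; $I_b=\{0,\ldots,b-1\}$; $L^p=L^p(\Omega)$. Tensor train approximation tool. For $L\ge0$ let $t_{b,L}(i_1,\ldots,i_L,\bar x)=b^{-L}\big(\sum_{k=1}^L i_kb^{L-k}+\bar x\big)$ for $i_k\in I_b$, $\bar x\in[0,1)$, and $t^D_{b,L}(i_1^1,\ldots,i_D^1,\ldots,i_1^L,\ldots,i_D^L,\bar x_1,\ldots,\bar x_D)=(t_{b,L}(i_1^1,\ldots,i_1^L,\bar x_1),\ldots,t_{b,L}(i_D^1,\ldots,i_D^L,\bar x_D))$; set $T^D_{b,L}f=f\circ t^D_{b,L}$. Let $V^D_{b,m}$ be the set of $f$ with $T^D_{b,L}f\in\mathbb R^{I_b^{LD}}\otimes S^{\otimes D}$ for some $L\ge0$. Fix a basis $\varphi_1,\ldots,\varphi_{\dim S}$ of $S$. For $L\ge0$ and $\boldsymbol r=(r_\nu)_{\nu=1}^{(L+1)D-1}$, $r_\nu\in\mathbb N_{\ge0}$, $r_0=r_{(L+1)D}=1$, let $\mathcal P_{b,L,S,\boldsymbol r}$ be the set of tuples $\boldsymbol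 U=(U_1,\ldots,U_{(L+1)D})$ with $U_\nu\in\mathbb R^{r_{\nu-1}\times b\times r_\nu}$ for $\nu\le LD$ and $U_\nu\in\mathbb R^{r_{\nu-1}\times\dim S\times r_\nu}$ for $LD<\nu\le(L+1)D$. The function $f=\mathcal R_{b,L,S,\boldsymbol r}(\boldsymbol U)$ is defined by $$(T^D_{b,L}f)(i_1,\ldots,i_{LD},\bar x_1,\ldots,\bar x_D)=\sum_{k_1,\ldots,k_{(L+1)D-1}}\ \sum_{n_1,\ldots,n_D=1}^{\dim S}\ \prod_{\nu=1}^{LD}U_\nu(k_{\nu-1},i_\nu,k_\nu)\prod_{\nu=1}^{D}U_{LD+\nu}(k_{LD+\nu-1},n_\nu,k_{LD+\nu})\,\varphi_{n_\nu}(\bar x_\nu),$$ with $(i_1,\ldots,i_{LD})=(i_1^1,\ldots,i_D^1,\ldots,i_1^L,\ldots,i_D^L)$, $1\le k_\nu\le r_\nu$, $k_0=k_{(L+1)D}=1$, empty sums being zero. $\mathrm{compl}_{\mathcal F}(\boldsymbol U)$ is the total number of entries of all $U_\nu$, $\mathrm{compl}_{\mathcal F}(\varphi)$ is its minimum over all representations ($L$, $\boldsymbol r$, $\boldsymbol U$) of $\varphi\in V^D_{b,m}$, and $\Phi^{\mathcal F}_n:=\{\varphi\in V^D_{b,m}:\mathrm{compl}_{\mathcal F}(\varphi)\le n\}$. Approximation space. With $E_n(f)=\inf_{\varphi\in\Phi^{\mathcal F}_n}\|f-\varphi\|_{L^p}$, $\mathcal F^s_q(L^p)$ is the set of $f\in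 L^p$ with finite quasi-norm $\big(\sum_{n\ge1}[n^sE_{n-1}(f)]^q\frac1n\big)^{1/q}$ ($\sup_{n\ge1}n^sE_{n-1}(f)$ for $q=\infty$). Isotropic Besov space. $\Delta_h^r=(\tau_h-\mathbb I)^r$ with $(\tau_hf)(x)=f(x+h)$, $\Delta_h^rf$ considered on $\{x\in\Omega:x+rh\in\Omega\}$; $r=\lfloor s_I\rfloor+1$; $\omega_r(f,t)_p=\sup_{0<|h|_2\le t}\|\Delta_h^rf\|_p$; $|f|_{B^{s_I}_q(L^p)}=\big(\int_0^1[t^{-s_I}\omega_r(f,t)_p]^q\frac{dt}{t}\big)^{1/q}$ (supremum over $t>0$ for $q=\infty$); $\|f\|_{B^{s_I}_q(L^p)}=\|f\|_p+|f|_{B^{s_I}_q(L^p)}$; $B^{s_I}_q(L^p(\Omega))$ is the set of $f\in L^p(\Omega)$ with finite norm. *)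

(* Defs.v *)
From HB Require Import structures.
From mathcomp Require Import all_boot all_order all_algebra qpoly.
From mathcomp Require Import all_classical all_reals all_analysis.
Set Implicit Arguments.
Unset Strict Implicit.
Unset Printing Implicit Defensive.
Import Order.TTheory GRing.Theory Num.Theory.
Import numFieldNormedType.Exports.
Local Open Scope classical_set_scope.
Local Open Scope ring_scope.

(* D.-tuple R carries the product Borel sigma-algebra.  Lebesgue measure on it is
   built by induction on D as the image of a binary product measure;
   lebesgue_tuple_box gives its value on boxes. *)
Section lebesgue_tuple.
Context {R : realType}.
Local Open Scope ereal_scope.

Definition cons_pair (n : nat) (z : n.-tuple R * R) : n.+1.-tuple R :=
  [the n.+1.-tuple R of z.2 :: z.1].

Lemma measurable_cons_pair (n : nat) :
  measurable_fun [set: n.-tuple R * R] (@cons_pair n).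
Proof. exact: measurable_cons. Qed.

Section succ.
Variables (n : nat) (mu : {measure set (n.-tuple R) -> \bar R}).

Definition lebesgue_tupleS : set (n.+1.-tuple R) -> \bar R :=
  pushforward (mu \x (@lebesgue_measure R)) (@cons_pair n).

Let mcons := @measurable_cons_pair n.

Let lebesgue_tupleS0 : lebesgue_tupleS set0 = 0.
Proof. exact: measure0. Qed.

Let lebesgue_tupleS_ge0 A : 0 <= lebesgue_tupleS A.
Proof. exact: measure_ge0. Qed.

Let lebesgue_tupleS_sigma_additive : semi_sigma_additive lebesgue_tupleS.
Proof. exact: measure_semi_sigma_additive. Qed.

HB.instance Definition _ := isMeasure.Build _ _ _ lebesgue_tupleS
  lebesgue_tupleS0 lebesgue_tupleS_ge0 lebesgue_tupleS_sigma_additive.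

End succ.

Fixpoint lebesgue_tuple (D : nat) : {measure set (D.-tuple R) -> \bar R} :=
  match D with
  | 0%N => \d_([tuple] : 0.-tuple R)
  | n.+1 => lebesgue_tupleS (lebesgue_tuple n)
  end.

Lemma measurable_box (D : nat) (A : 'I_D -> set R) :
  (forall d, measurable (A d)) ->
  measurable [set x : D.-tuple R | forall d, A d (tnth x d)].
Proof.
move=> mA; rewrite (_ : mkset _ = \bigcap_(d in [set: 'I_D])
    ((fun x : D.-tuple R => tnth x d) @^-1` A d)); last first.
  by apply/seteqP; split => x /= h d => [_|]; exact: h.
apply: fin_bigcap_measurable => // d _.
by rewrite -[X in measurable X]setTI; exact: measurable_tnth.
Qed.

Lemma lebesgue_tuple_box (D : nat) (A : 'I_D -> set R) :
  (forall d, measurable (A d)) ->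
  lebesgue_tuple D [set x | forall d, A d (tnth x d)] =
  \big[*%E/1]_(d < D) lebesgue_measure (A d).
Proof.
elim: D A => [|D IH] A mA.
  by rewrite big_ord0 /= diracE mem_set//= => -[].
rewrite big_ord_recl muleC -(IH (fun d => A (lift ord0 d)))//.
have mB := @measurable_box D (fun d => A (lift ord0 d)) (fun d => mA _).
apply: (etrans _ (product_measure1E
  (lebesgue_tuple D) (@lebesgue_measure R) mB (mA ord0))).
rewrite /= /lebesgue_tupleS /pushforward; congr (_ _).
have consE (x : D.-tuple R) y j : tnth (cons_pair (x, y)) (lift ord0 j) = tnth x j.
  by rewrite tnthS; congr tnth; exact/val_inj.
apply/seteqP; split => [[x y] /= h|[x y] /= [h1 h2] d].
  by split=> [d|]; [rewrite -(consE x y); exact: h|exact: (h ord0)].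
by case: (unliftP ord0 d) => [j ->|->//]; rewrite consE.
Qed.

End lebesgue_tuple.

Section function_spaces.
Context {R : realType}.

Definition unit_cube (D : nat) : set (D.-tuple R) :=
  [set x | forall d, 0 <= tnth x d < 1].

(* ||f||_{L^p(A)}, for 0 < p <= +oo *)
Definition Lpnorm (D : nat) (p : \bar R) (A : set (D.-tuple R))
    (f : D.-tuple R -> R) : \bar R :=
  'N[lebesgue_tuple D]_p[(EFin \o f) \_ A].

(* Functions on the cube are represented by total functions on D.-tuple R,
   whose values outside the cube are never used. *)
Definition Lp (D : nat) (p : \bar R) : set (D.-tuple R -> R) :=
  [set f | measurable_fun (@unit_cube D) f /\
           (Lpnorm p (@unit_cube D) f < +oo)%E].

Definition shift_tuple (D : nat) (h x : D.-tuple R) : D.-tuple R :=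
  [tuple tnth x d + tnth h d | d < D].

Definition norm2 (D : nat) (h : D.-tuple R) : R :=
  Num.sqrt (\sum_(d < D) tnth h d ^+ 2).

Definition diff_op (D r : nat) (h : D.-tuple R) (f : D.-tuple R -> R) :
    D.-tuple R -> R :=
  iter r (fun (g : D.-tuple R -> R) x => g (shift_tuple h x) - g x) f.

Definition diff_dom (D r : nat) (h : D.-tuple R) : set (D.-tuple R) :=
  [set x | unit_cube x /\ unit_cube (iter r (shift_tuple h) x)].

Local Open Scope ereal_scope.

Definition modulus (D r : nat) (p : \bar R) (f : D.-tuple R -> R) (t : R) :
    \bar R :=
  ereal_sup [set Lpnorm p (diff_dom r h) (diff_op r h f) |
             h in [set h : D.-tuple R | (0 < norm2 h <= t)%R]].

(* The -oo branches below are junk values: only 0 < q <= +oo is used. *)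
Definition besov_seminorm (D : nat) (sI : R) (p q : \bar R)
    (f : D.-tuple R -> R) : \bar R :=
  let r := (Num.truncn sI).+1 in
  match q with
  | q%:E => (\int[lebesgue_measure]_(t in `]0%R, 1%R[)
      (((t `^ (- sI))%:E * modulus r p f t) `^ q * (t^-1)%:E)) `^ q^-1
  | +oo => ereal_sup [set (t `^ (- sI))%:E * modulus r p f t |
                      t in [set t : R | (0 < t)%R]]
  | -oo => 0
  end.

Definition besov_norm (D : nat) (sI : R) (p q : \bar R)
    (f : D.-tuple R -> R) : \bar R :=
  Lpnorm p (@unit_cube D) f + besov_seminorm sI p q f.

Definition besov_space (D : nat) (sI : R) (p q : \bar R) :
    set (D.-tuple R -> R) :=
  [set f | Lp p f /\ besov_norm sI p q f < +oo].

Definition best_error (D : nat) (p : \bar R)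
    (Phi : nat -> set (D.-tuple R -> R)) (n : nat) (f : D.-tuple R -> R) :
    \bar R :=
  ereal_inf [set Lpnorm p (@unit_cube D) (f \- phi)%R | phi in Phi n].

Definition approx_norm (D : nat) (s : R) (p q : \bar R)
    (Phi : nat -> set (D.-tuple R -> R)) (f : D.-tuple R -> R) : \bar R :=
  match q with
  | q%:E => (\sum_(1 <= n <oo)
      (((n%:R `^ s)%:E * best_error p Phi n.-1 f) `^ q * (n%:R^-1)%:E)) `^ q^-1
  | +oo => ereal_sup [set (n%:R `^ s)%:E * best_error p Phi n.-1 f |
                      n in [set n : nat | (1 <= n)%N]]
  | -oo => 0
  end.

Definition approx_space (D : nat) (s : R) (p q : \bar R)
    (Phi : nat -> set (D.-tuple R -> R)) : set (D.-tuple R -> R) :=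
  [set f | Lp p f /\ approx_norm s p q Phi f < +oo].

Definition continuously_embedded (D : nat)
    (X : set (D.-tuple R -> R)) (normX : (D.-tuple R -> R) -> \bar R)
    (Y : set (D.-tuple R -> R)) (normY : (D.-tuple R -> R) -> \bar R) : Prop :=
  X `<=` Y /\
  exists2 C : R, (0 < C)%R & forall f, X f -> normY f <= C%:E * normX f.

End function_spaces.

Section tensor_trains.
Context {R : realType}.

Definition t_map (b L : nat) (i : 'I_L -> 'I_b) (x : R) : R :=
  (b%:R ^+ L)^-1 * (\sum_(k < L) (i k)%:R * b%:R ^+ (L - k.+1) + x).

Lemma digit_index_proof (L D : nat) (k : 'I_L) (d : 'I_D) : (k * D + d < L * D)%N.
Proof.
apply: (@leq_trans (k.+1 * D)); last by rewrite leq_mul2r ltn_ord orbT.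
by rewrite mulSn addnC ltn_add2r.
Qed.

(* Position of the level-k digit of coordinate d in
   (i_1^1, ..., i_D^1, ..., i_1^L, ..., i_D^L), all indices from 0. *)
Definition digit_index (L D : nat) (k : 'I_L) (d : 'I_D) : 'I_(L * D) :=
  Ordinal (digit_index_proof k d).

Definition tD_map (b L D : nat) (i : 'I_(L * D) -> 'I_b) (x : D.-tuple R) :
    D.-tuple R :=
  [tuple t_map (fun k => i (digit_index k d)) (tnth x d) | d < D].

Definition tensorize (b L D : nat) (f : D.-tuple R -> R) :
    ('I_(L * D) -> 'I_b) -> D.-tuple R -> R :=
  fun i x => f (tD_map i x).

(* g, restricted to the cube in its second argument, is a finite sum of
   elementary tensors v (x) p_1 (x) ... (x) p_D. *)
Definition in_tensor_product (b m L D : nat)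
    (g : ('I_(L * D) -> 'I_b) -> D.-tuple R -> R) : Prop :=
  exists (N : nat) (v : 'I_N -> ('I_(L * D) -> 'I_b) -> R)
         (P : 'I_N -> 'I_D -> {poly_(m.+1) R}),
    forall i x, unit_cube x ->
      g i x = \sum_(j < N) v j i * \prod_(d < D) (P j d : {poly R}).[tnth x d].

Definition V_space (b m D : nat) : set (D.-tuple R -> R) :=
  [set f | exists L, in_tensor_product m (@tensorize b L D f)].

(* Cores are indexed from 0, so that r nu and r nu.+1 are the bond dimensions
   of core nu; dim S = m.+1.  Only r 0, ..., r (L.+1 * D) matter. *)
Record tt_cores (b m L D : nat) (r : nat -> nat) := TTCores {
  disc_core : forall nu : 'I_(L * D), 'I_(r nu) -> 'I_b -> 'I_(r nu.+1) -> R;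
  feat_core : forall nu : 'I_D,
    'I_(r (L * D + nu)) -> 'I_m.+1 -> 'I_(r (L * D + nu).+1) -> R }.

Definition admissible_ranks (L D : nat) (r : nat -> nat) : Prop :=
  (r 0 = 1 /\ r (L.+1 * D) = 1)%N.

Lemma disc_bond (L D : nat) (nu : 'I_(L * D)) : (nu.+1 < (L.+1 * D).+1)%N.
Proof. by rewrite ltnS mulSn (leq_trans (ltn_ord nu))// leq_addl. Qed.

Lemma feat_bond (L D : nat) (nu : 'I_D) : ((L * D + nu).+1 < (L.+1 * D).+1)%N.
Proof. by rewrite ltnS mulSn addnC ltn_add2r. Qed.

(* k ranges over all (k_0, ..., k_{(L+1)D}); for admissible ranks the two
   extreme indices take a single value. *)
Definition tt_eval (b m L D : nat) (phi : m.+1.-tuple {poly_(m.+1) R})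
    (r : nat -> nat) (U : tt_cores b m L D r)
    (i : 'I_(L * D) -> 'I_b) (x : D.-tuple R) : R :=
  \sum_(k : {dffun forall nu : 'I_(L.+1 * D).+1, 'I_(r nu)})
  \sum_(n : {ffun 'I_D -> 'I_m.+1})
    (\prod_(nu < L * D)
       disc_core U (k (Ordinal (ltnW (disc_bond nu)))) (i nu)
                   (k (Ordinal (disc_bond nu)))) *
    (\prod_(nu < D)
       (feat_core U (k (Ordinal (ltnW (feat_bond L nu)))) (n nu)
                    (k (Ordinal (feat_bond L nu))) *
        (tnth phi (n nu) : {poly R}).[tnth x nu])).

(* f = R_{b,L,S,r}(U) on the cube *)
Definition represents (b m L D : nat) (phi : m.+1.-tuple {poly_(m.+1) R})
    (r : nat -> nat) (U : tt_cores b m L D r) (f : D.-tuple R -> R) : Prop :=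
  forall i x, unit_cube x -> tensorize f i x = tt_eval phi U i x.

Definition compl_ranks (b m L D : nat) (r : nat -> nat) : nat :=
  (\sum_(nu < L * D) r nu * b * r nu.+1 +
   \sum_(nu < D) r (L * D + nu) * m.+1 * r (L * D + nu).+1)%N.

Definition compl (b m D : nat) (phi : m.+1.-tuple {poly_(m.+1) R})
    (f : D.-tuple R -> R) : \bar R :=
  ereal_inf [set c | exists (L : nat) (r : nat -> nat) (U : tt_cores b m L D r),
    [/\ admissible_ranks L D r, represents phi U f &
        c = ((compl_ranks b m L D r)%:R)%:E]].

Definition Phi_F (b m D : nat) (phi : m.+1.-tuple {poly_(m.+1) R}) (n : nat) :
    set (D.-tuple R -> R) :=
  [set f | V_space b m f /\ (compl b phi f <= n%:R%:E)%E].

End tensor_trains.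

(* Main.v *)
(* Let f_L(x) = (-1)^floor(b^L x_1).  This square wave is a tensor train all of
   whose ranks are 1, so its complexity N grows linearly in L, and its
   approximation norm is at most N^(s + 1/q) because E_n(f_L) <= 1 and
   E_n(f_L) = 0 for n >= N.  The shift h = b^-L e_1 flips its sign, so
   |Delta_h^r f_L| = 2^r wherever it is defined; hence its modulus of smoothness
   is bounded below for all t >= b^-L and its Besov norm grows at least like
   b^(L sI), which no power of L can bound. *)
Require Import Defs.
From mathcomp Require Import all_boot all_order all_algebra qpoly.
From mathcomp Require Import all_classical all_reals all_analysis.
From mathcomp Require Import ess_sup_inf measurable_realfun ring.
Set Implicit Arguments.
Unset Strict Implicit.
Unset Printing Implicit Defensive.
Import Order.TTheory GRing.Theory Num.Theory.
Import numFieldNormedType.Exports.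
Local Open Scope ring_scope.
Local Open Scope classical_set_scope.

(** * Monotonicity of L^p norms and norms of indicator functions *)

Section norms.
Local Open Scope ereal_scope.
Context d (T : measurableType d) (R : realType).
Variable mu : {measure set T -> \bar R}.

(* The integral of a nonnegative function is the supremum over the simple
   functions below it, so monotonicity needs no measurability; this avoids
   showing that t |-> modulus r p f t is measurable. *)
Lemma le_integral_nonmeasurable (A : set T) (f g : T -> \bar R) :
  (forall x, A x -> 0 <= f x) -> (forall x, A x -> f x <= g x) ->
  \int[mu]_(x in A) f x <= \int[mu]_(x in A) g x.
Proof.
move=> f0 fg; rewrite !(integral_mkcond A).
have fg' x : (f \_ A) x <= (g \_ A) x by exact: lee_restrict.
have f0' x : 0 <= (f \_ A) x by exact: erestrict_ge0.
rewrite !ge0_integralTE//; last by move=> x; exact: le_trans (f0' x) (fg' x).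
by apply: ereal_sup_le => _ [h hf <-]; exists h => // x; exact: le_trans (hf x) _.
Qed.

Lemma le_poweR (r : R) (x y : \bar R) : (0 <= r)%R -> 0 <= x -> x <= y ->
  x `^ r <= y `^ r.
Proof.
move=> r0 x0 xy; apply: gt0_ler_poweR => //; rewrite in_itv/= leey andbT//.
exact: le_trans xy.
Qed.

Lemma Lnorm_le (p : \bar R) (f g : T -> \bar R) : 0 < p ->
  (forall x, `|f x| <= `|g x|) -> 'N[mu]_p[f] <= 'N[mu]_p[g].
Proof.
move=> p0 fg; rewrite unlock; case: p p0 => [r| |]//=.
- rewrite lte_fin => r0; apply: le_poweR; first by rewrite invr_ge0 ltW.
    by apply: integral_ge0 => x _; exact: poweR_ge0.
  apply: le_integral_nonmeasurable => x _; first exact: poweR_ge0.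
  by apply: le_poweR => //; exact: ltW.
(* For [p = +oo] the norm is the essential supremum only if the space has positive measure, and 0
   otherwise. *)
- move=> _; case: ifP => // _; apply: le_ess_sup; exact: nearW.
Qed.

Lemma Lnorm_indic_le1 (p : \bar R) (A : set T) : 0 < p -> measurable A ->
  mu A <= 1 -> 'N[mu]_p[(cst 1) \_ A] <= 1.
Proof.
move=> p0 mA A1; rewrite unlock; case: p p0 => [r| |]//=.
- rewrite lte_fin => r0; rewrite -[leRHS](poweR1r r^-1).
  apply: le_poweR; first by rewrite invr_ge0 ltW.
    by apply: integral_ge0 => x _; exact: poweR_ge0.
  rewrite (eq_integral (((cst 1) : T -> \bar R) \_ A)); last first.
    move=> x _; rewrite /patch; case: ifP => _; rewrite ?abse1 ?abse0.
      by rewrite poweR1r.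
    by rewrite poweR0r// gt_eqF.
  by rewrite -integral_mkcond integral_cst// mul1e.
- move=> _; case: ifP => // _; apply/ess_supP; apply: nearW => x /=.
  by rewrite /patch; case: ifP => _; rewrite ?abse1 ?abse0.
Qed.

(** If the norm were zero, the indicator would vanish almost everywhere and [A] would lie in a null
    set. This treats all [p] at once. *)
Lemma Lnorm_indic_gt0 (p : \bar R) (A : set T) : 0 < p -> measurable A ->
  0 < mu A -> 0 < 'N[mu]_p[(cst 1) \_ A].
Proof.
move=> p0 mA A0; rewrite lt_def Lnorm_ge0 andbT; apply/eqP => h.
have mf : @measurable_fun _ _ T (\bar R) setT ((cst 1 : T -> \bar R) \_ A).
  by apply/(measurable_restrictT _ mA)/measurable_cst.
have [N [mN N0 sub]] := Lnorm_eq0_eq0 mf p0 h; have : mu A <= mu N.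
  apply: le_measure; rewrite ?inE// => x Ax; apply: sub => /=.
  by move=> /(_ Logic.I); rewrite patchE mem_set// => /eqP; rewrite onee_eq0.
by rewrite N0 leNgt A0.
Qed.
End norms.

(** * The one-dimensional square wave *)

Section square_wave.
Context {R : realType}.

Definition square_wave (z : R) : R := (-1) ^ Num.floor z.

Lemma square_waveS (z : R) : square_wave (z + 1) = - square_wave z.
Proof.
by rewrite /square_wave floorDrz// floor1 expfzDr ?oppr_eq0 ?oner_eq0// expr1z mulrN1.
Qed.

Lemma norm_square_wave (z : R) : `|square_wave z| = 1.
Proof. by rewrite /square_wave expN1r normrX normrN1 expr1n. Qed.

Lemma square_waveDn (n : nat) (y : R) : 0 <= y < 1 ->
  square_wave (n%:R + y) = (-1) ^+ n.
Proof.
move=> /andP[y0 y1]; rewrite /square_wave (floor_def (m := Posz n))//.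
by rewrite intrD pmulrn lerDl ltrD2l y0.
Qed.

(** This makes the square wave a continuous function of the nondecreasing floor, hence
    measurable. *)
Lemma cos_pi_int (k : int) : cos (k%:~R * pi) = (-1) ^ k :> R.
Proof.
have cosn (n : nat) : cos (n%:R * pi) = (-1) ^+ n :> R.
  elim: n => [|n IH]; first by rewrite mul0r cos0.
  by rewrite -natr1 mulrDl mul1r cosD cospi sinpi mulr0 subr0 mulrN1 IH exprS mulN1r.
rewrite expN1r; case: k => n; first exact: cosn.
by rewrite NegzE mulrNz mulNr cosN abszN; exact: cosn.
Qed.

Lemma measurable_square_wave : measurable_fun [set: R] square_wave.
Proof.
rewrite (_ : square_wave = cos \o (fun z => (Num.floor z)%:~R * pi)); last first.
  by apply/funext => z /=; rewrite cos_pi_int.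
apply: measurableT_comp.
  by apply: continuous_measurable_fun; exact: continuous_cos.
apply: measurable_funM => //; apply: nondecreasing_measurable => // x y xy.
by rewrite ler_int; exact: le_floor.
Qed.

End square_wave.

(** * Rank-one tensor trains for the square wave, and the zero function *)

Section tensor_train.
Context {R : realType}.

Lemma size_poly1_leS (m : nat) : (1 : {poly R}) \is a poly_of_size m.+1.
Proof. by rewrite qualifE/= size_poly1. Qed.

Definition npoly1 (m : nat) : {poly_(m.+1) R} := NPoly (size_poly1_leS m).

Variables (b D m : nat) (d0 : 'I_D).
Hypothesis b_gt1 : (1 < b)%N.
Variable phi : m.+1.-tuple {poly_(m.+1) R}.
Hypothesis hphi : basis_of fullv phi.

Definition osc (L : nat) (x : D.-tuple R) : R :=
  square_wave (b%:R ^+ L * tnth x d0).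

(* The parity of the integer with digits i_1, ..., i_L is the sum of the
   parities of the i_k b^(L-k), so the square wave is a product of functions of
   one digit each: all tensor train ranks are 1. *)
Definition osc_digit (L nu j : nat) : R :=
  if (nu %% D == d0)%N then (-1) ^+ (j * b ^ (L - (nu %/ D).+1)) else 1.

Lemma tensorize_osc (L : nat) (i : 'I_(L * D) -> 'I_b) x : unit_cube x ->
  tensorize (osc L) i x = \prod_(nu < L * D) osc_digit L nu (i nu).
Proof.
move=> ux; rewrite /tensorize /osc /tD_map tnth_mktuple /t_map.
rewrite mulrA divff ?mul1r; last by rewrite expf_neq0// pnatr_eq0 -lt0n ltnW.
rewrite (eq_bigr (fun k : 'I_L => ((i (digit_index k d0) * b ^ (L - k.+1))%N%:R : R))).
  2: by move=> k _; rewrite natrM natrX.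
rewrite -natr_sum square_waveDn// expr_sum.
(* Digits of coordinates other than [d0] contribute the factor 1; on the remaining positions,
   division by [D] recovers the level [k]. *)
rewrite [RHS](bigID (fun nu : 'I_(L * D) => (nu %% D == d0)%N))/=.
rewrite [X in _ = _ * X]big1 ?mulr1; last first.
  by move=> nu /negbTE h; rewrite /osc_digit h.
have D0 : (0 < D)%N by exact: leq_ltn_trans (ltn_ord d0).
have qP (nu : 'I_(L * D)) : (nu %/ D < L)%N by rewrite ltn_divLR.
rewrite [RHS](reindex_onto (fun k => digit_index k d0) (fun nu => Ordinal (qP nu)))/=.
  2: by move=> nu /eqP h; apply/val_inj => /=; rewrite -h -divn_eq.
apply: eq_big => [k|k _] /=.
  rewrite modnMDl modn_small// eqxx/=; apply/esym/eqP/val_inj => /=.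
  by rewrite divnMDl// divn_small// addn0.
by rewrite /osc_digit /= modnMDl modn_small// eqxx divnMDl// divn_small// addn0.
Qed.

Lemma osc_V_space (L : nat) : V_space b m (osc L).
Proof.
exists L, 1%N, (fun _ i => \prod_(nu < L * D) osc_digit L nu (i nu)),
  (fun _ _ => npoly1 m) => i x ux.
rewrite big_ord1 tensorize_osc// [X in _ * X]big1 ?mulr1// => d _.
by rewrite hornerE.
Qed.

(** Since [phi] is arbitrary, the feature cores store the coordinates of the constant polynomial
    1. *)
Definition osc_cores (L : nat) : tt_cores (R := R) b m L D (fun=> 1%N) :=
  TTCores (fun (nu : 'I_(L * D)) _ (j : 'I_b) _ => osc_digit L nu j)
          (fun _ _ n _ => coord phi n (npoly1 m)).

Lemma osc_represents (L : nat) : represents phi (osc_cores L) (osc L).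
Proof.
move=> i x ux; rewrite tensorize_osc// /tt_eval.
pose k0 : {dffun forall nu : 'I_(L.+1 * D).+1, 'I_1} := [ffun=> ord0].
rewrite (big_pred1 k0) => [|k]; last by apply/esym/eqP/ffunP => nu; rewrite !ord1.
(* The sum over all [n] factors into one sum per coordinate, each being the expansion of 1 in the
   basis. *)
rewrite -big_distrr/= -(bigA_distr_bigA (fun nu n => coord phi n (npoly1 m) *
  (tnth phi n : {poly R}).[tnth x nu])) [X in _ * X]big1 ?mulr1// => d _.
transitivity ((npoly1 m : {poly R}).[tnth x d]); last by rewrite hornerE.
rewrite [in RHS](coord_basis hphi (memvf (npoly1 m))) raddf_sum/= horner_sum.
by apply: eq_bigr => n _; rewrite hornerZ (tnth_nth 0).
Qed.

Lemma osc_Phi_F (L n : nat) : (L * D * b + D * m.+1 <= n)%N ->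
  Phi_F b phi n (osc L).
Proof.
move=> hn; split; first exact: osc_V_space.
apply: ereal_inf_le; exists ((compl_ranks b m L D (fun=> 1%N))%:R%:E).
  by exists L, (fun=> 1%N), (osc_cores L); split=> //; exact: osc_represents.
rewrite lee_fin ler_nat (leq_trans _ hn)// /compl_ranks !sum_nat_const !card_ord.
by rewrite !mul1n !muln1.
Qed.

(** The case [n = 0] matters: the approximation norm contains E_0, which must be bounded by the norm
    of the function. *)
Lemma zero_Phi_F (n : nat) : Phi_F b phi n (fun _ : D.-tuple R => 0).
Proof.
split.
  exists 0%N, 0%N, (fun _ _ => 0), (fun _ _ => 0) => i x _.
  by rewrite big_ord0.
(* Vanishing interior ranks give a representation without any entry. *)
pose r (nu : nat) : nat := ((nu == 0) || (nu == 2 * D))%N.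
have D0 : (0 < D)%N by exact: leq_ltn_trans (ltn_ord d0).
apply: ereal_inf_le; exists ((compl_ranks b m 1 D r)%:R%:E).
  (* The level is 1 because at level 0 with D = 1 there is a single core and no interior rank to set
     to zero. *)
  exists 1%N, r, (TTCores (fun _ _ _ _ => 0) (fun _ _ _ _ => 0)); split=> //.
    by split; rewrite /r ?eqxx// orbT.
  move=> i x ux; rewrite /tensorize /tt_eval big1// => k _; rewrite big1// => f _.
  by rewrite [X in _ * X](bigD1 d0)//= !mul0r mulr0.
rewrite lee_fin ler_nat /compl_ranks.
(* The ranks are nonzero only at 0 and 2D, which are not adjacent as D > 0. *)
have r0 nu : (r nu * r nu.+1 = 0)%N.
  rewrite /r; have [->|nu0] := eqVneq nu 0%N.
    by rewrite mul1n; case: (D) D0 => // -[].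
  have [->|//] := eqVneq nu (2 * D)%N.
  by rewrite (gtn_eqF (ltnSn _)).
by rewrite !big1// => nu _; rewrite mulnAC r0.
Qed.
End tensor_train.

(** * Norms on the unit cube and the upper bound for the approximation norm *)

Section cube.
Context {R : realType}.
Variable D : nat.
Implicit Types (p : \bar R).
Local Open Scope ereal_scope.

Lemma unit_cubeE :
  @unit_cube R D = [set x | forall d, (fun=> `[0%R, 1%R[%classic) d (tnth x d)].
Proof. by apply/seteqP; split => x /= h d; have := h d; rewrite /= in_itv. Qed.

Lemma measurable_unit_cube : measurable (@unit_cube R D).
Proof. by rewrite unit_cubeE; apply: (@measurable_box R D (fun=> _)). Qed.

Lemma lebesgue_unit_cube : lebesgue_tuple D (@unit_cube R D) = 1.
Proof.
rewrite unit_cubeE (@lebesgue_tuple_box R D (fun=> _))// big1// => d _.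
by rewrite lebesgue_measure_itv/= lte_fin ltr01 sube0.
Qed.

Lemma Lpnorm_ge0 p (A : set (D.-tuple R)) f : 0 <= Lpnorm p A f.
Proof. exact: Lnorm_ge0. Qed.

Lemma Lpnorm_le p (A B : set (D.-tuple R)) f g : 0 < p -> A `<=` B ->
  (forall x, A x -> (`|f x| <= `|g x|)%R) -> Lpnorm p A f <= Lpnorm p B g.
Proof.
move=> p0 AB fg; apply: Lnorm_le => // x; rewrite /patch.
case: ifPn => [|_]; last by rewrite abse0 abse_ge0.
by rewrite inE => Ax; rewrite mem_set; [rewrite lee_fin; exact: fg|exact: AB].
Qed.

Lemma Lpnorm_cube_le1 p (f : D.-tuple R -> R) : 0 < p ->
  (forall x, unit_cube x -> (`|f x| <= 1)%R) -> Lpnorm p (@unit_cube R D) f <= 1.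
Proof.
move=> p0 f1; apply: (@le_trans _ _ (Lpnorm p (@unit_cube R D) (cst 1%R))).
  by apply: Lpnorm_le => // x ux; rewrite /= normr1; exact: f1.
apply: Lnorm_indic_le1 => //; first exact: measurable_unit_cube.
by rewrite lebesgue_unit_cube.
Qed.

(** A region independent of [L] that stays in the cube under the [r] successive small shifts used
    below. *)
Definition half_cube : set (D.-tuple R) :=
  [set x | forall d, `[0%R, 2^-1%R[%classic (tnth x d)].

Lemma half_cube_gt0 p : 0 < p -> 0 < Lpnorm p half_cube (cst 1%R).
Proof.
move=> p0; apply: Lnorm_indic_gt0 => //; first exact: (@measurable_box R D (fun=> _)).
rewrite (@lebesgue_tuple_box R D (fun=> _))// (eq_bigr (fun=> (2^-1)%:E)).
  by rewrite prodEFin lte_fin prodr_gt0// => d _; rewrite invr_gt0.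
by move=> d _; rewrite lebesgue_measure_itv/= lte_fin invr_gt0 ltr0n/= sube0.
Qed.

Lemma half_cube_sub : half_cube `<=` @unit_cube R D.
Proof.
move=> x h d; have := h d; rewrite /= in_itv/= => /andP[-> /lt_le_trans]; apply.
by rewrite invf_le1// ler1n.
Qed.

Lemma best_error_ge0 p Phi n (f : D.-tuple R -> R) : 0 <= best_error p Phi n f.
Proof. by apply: le_ereal_inf_tmp => _ [g _ <-]; exact: Lpnorm_ge0. Qed.

Lemma best_error_le p (Phi : nat -> set (D.-tuple R -> R)) n f : Phi n (fun=> 0%R) ->
  best_error p Phi n f <= Lpnorm p (@unit_cube R D) f.
Proof.
move=> h; apply: ereal_inf_lbound; exists (fun=> 0%R) => //.
by congr Lpnorm; apply/funext => x /=; rewrite subr0.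
Qed.

Lemma best_error_eq0 p (Phi : nat -> set (D.-tuple R -> R)) n f : 0 < p -> Phi n f ->
  best_error p Phi n f = 0.
Proof.
move=> p0 h; apply/eqP; rewrite eq_le best_error_ge0 andbT.
apply: ereal_inf_lbound; exists f => //.
rewrite -(@Lnorm0 _ _ _ (lebesgue_tuple D) p (negbT (gt_eqF p0))); congr Lnorm.
by apply/funext => x; rewrite /patch/= subrr; case: ifP.
Qed.

Definition approx_exponent (s : R) (q : \bar R) : R :=
  if q is r%:E then (s + r^-1)%R else s.

(** At most [N] terms survive, each with n^s E_{n-1}(f) <= N^s. For finite [q], bounding the weights
    1/n by 1 costs a factor N^(1/q). *)
Lemma approx_norm_le (s : R) p q (Phi : nat -> set (D.-tuple R -> R)) f (N : nat) :
  (0 < s)%R -> 0 < p -> 0 < q -> (0 < N)%N ->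
  (forall n, Phi n (fun=> 0%R)) -> (forall n, (N <= n)%N -> Phi n f) ->
  Lpnorm p (@unit_cube R D) f <= 1 ->
  approx_norm s p q Phi f <= (N%:R `^ approx_exponent s q)%:E.
Proof.
move=> s0 p0 q0 N0 Phi0 Phif f1.
have E1 n : best_error p Phi n f <= 1 by exact: le_trans (best_error_le _ _ (Phi0 _)) f1.
have term_le n : (n <= N)%N ->
    (n%:R `^ s)%:E * best_error p Phi n.-1 f <= (N%:R `^ s)%:E.
  move=> nN; rewrite -[leRHS]mule1 lee_pmul ?lee_fin ?powR_ge0 ?best_error_ge0//.
  by apply: ge0_ler_powR; rewrite ?nnegrE ?ler0n ?ler_nat// ltW.
(* The strict inequality absorbs the index shift: it gives N <= n - 1. *)
have term0 n : (N < n)%N -> (n%:R `^ s)%:E * best_error p Phi n.-1 f = 0.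
  by move=> Nn; rewrite best_error_eq0 ?mule0//; apply: Phif; case: n Nn.
have term_ge0 n : 0 <= (n%:R `^ s)%:E * best_error p Phi n.-1 f.
  by rewrite mule_ge0 ?lee_fin ?powR_ge0 ?best_error_ge0.
case: q q0 => [r| |]//=.
- rewrite lte_fin => r0.
  have -> : (N%:R `^ (s + r^-1) = ((N%:R `^ s) `^ r * N%:R) `^ r^-1)%R.
    rewrite powRM ?powR_ge0// -!powRrM divff ?gt_eqF// mulr1 powRD//.
    by rewrite pnatr_eq0 -lt0n N0 implybT.
  rewrite -poweR_EFin.
  pose u n := ((n%:R `^ s)%:E * best_error p Phi n.-1 f) `^ r * (n%:R^-1)%:E.
  rewrite -[X in limn X]/(fun n => \sum_(1 <= k < n) u k).
  have u0 n : 0 <= u n.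
    by rewrite mule_ge0 ?poweR_ge0// lee_fin invr_ge0.
  apply: le_poweR; first by rewrite invr_ge0 ltW.
    by apply: nneseries_ge0 => n _ _.
  rewrite (@nneseries_split _ u 1 N)//.
  rewrite [X in _ + X]eseries0 ?adde0; last first.
    by move=> n nN _; rewrite /u term0// poweR0r ?gt_eqF// mul0e.
  apply: (@le_trans _ _ (\sum_(1 <= k < 1 + N) ((N%:R `^ s) `^ r)%:E)).
    rewrite !big_nat; apply: lee_sum => n /andP[n1 nN].
    rewrite -[leRHS]mule1 /u lee_pmul ?poweR_ge0 ?lee_fin ?invr_ge0//.
      rewrite -[leRHS]poweR_EFin; apply: le_poweR => //; first exact: ltW.
      by apply: term_le; rewrite add1n ltnS in nN.
    by rewrite invf_le1 ?ltr0n// ler1n.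
  by rewrite sumEFin sumr_const_nat add1n subn1/= lee_fin mulr_natr.
- move=> _; apply: ge_ereal_sup => _ [n _ <-].
  have [nN|Nn] := leqP n N; first exact: term_le.
  by rewrite term0// lee_fin powR_ge0.
Qed.
End cube.

(** * The lower bound for the Besov norm *)

Section besov.
Context {R : realType}.
Variables (b D : nat) (d0 : 'I_D).
Hypothesis b_gt1 : (1 < b)%N.

Definition osc_step (L : nat) : D.-tuple R :=
  [tuple if d == d0 then (b%:R ^+ L)^-1 else 0 | d < D].

Let bL_gt0 (L : nat) : 0 < b%:R ^+ L :> R.
Proof. by rewrite exprn_gt0// ltr0n ltnW. Qed.

Lemma norm2_osc_step (L : nat) : norm2 (osc_step L) = (b%:R ^+ L)^-1.
Proof.
rewrite /norm2 (bigD1 d0)//= big1 => [|d /negbTE dd0]; last first.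
  by rewrite tnth_mktuple dd0 expr0n.
by rewrite tnth_mktuple eqxx addr0 sqrtr_sqr ger0_norm// invr_ge0 ltW.
Qed.

(** The shift moves the argument of the square wave by exactly 1, so [osc] is an eigenfunction of
    the first difference with eigenvalue -2. *)
Lemma diff_op_osc (r L : nat) (x : D.-tuple R) :
  diff_op r (osc_step L) (osc b d0 L) x = (-2) ^+ r * osc b d0 L x.
Proof.
elim: r x => [|r IH] x; first by rewrite mul1r.
rewrite /diff_op /= -!/(diff_op r _ _ _) !IH exprS -mulrA -mulrBr.
have -> : osc b d0 L (shift_tuple (osc_step L) x) = - osc b d0 L x.
  by rewrite /osc !tnth_mktuple eqxx mulrDr divff ?gt_eqF// square_waveS.
by rewrite mulrCA; congr (_ * _); rewrite mulNr mulr_natl mulr2n opprD.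
Qed.

Lemma tnth_iter_shift (r : nat) (h x : D.-tuple R) d :
  tnth (iter r (shift_tuple h) x) d = tnth x d + r%:R * tnth h d.
Proof.
elim: r => [|r IH] /=; first by rewrite mul0r addr0.
by rewrite tnth_mktuple IH -natr1 mulrDl mul1r addrA.
Qed.

Lemma half_cube_diff_dom (r L : nat) : (2 * r <= L)%N ->
  @half_cube R D `<=` diff_dom r (osc_step L).
Proof.
move=> rL x hx; split; first exact: half_cube_sub.
move=> d; rewrite tnth_iter_shift tnth_mktuple.
have := hx d; rewrite /= in_itv/= => /andP[x0 x1].
(* The total displacement r b^-L is at most 1/2 because 2r <= L < b^L. *)
have sL : 0 <= r%:R * (if d == d0 then (b%:R ^+ L)^-1 else 0 : R) <= 2^-1.
  case: eqP => _; last by rewrite mulr0 lexx invr_ge0 ler0n.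
  rewrite mulr_ge0 ?invr_ge0 ?(ltW (bL_gt0 _))//= ler_pdivrMr// mulrC ler_pdivlMr//.
  rewrite -natrX -natrM ler_nat mulnC (leq_trans rL)//.
  by rewrite ltnW// ltn_expl.
by move: sL => /andP[s0 s1]; rewrite addr_ge0//= [ltRHS](splitr 1) mul1r ltr_leD.
Qed.

Local Open Scope ereal_scope.

(** The shift [osc_step L] is admissible for such [t], and its difference has absolute value 2^r >=
    1. *)
Lemma modulus_osc_ge (p : \bar R) (r L : nat) (t : R) : 0 < p ->
  (2 * r <= L)%N -> ((b%:R ^+ L)^-1 <= t)%R ->
  Lpnorm p (@half_cube R D) (cst 1%R) <= modulus r p (osc b d0 L) t.
Proof.
move=> p0 rL ht; apply: le_trans (ereal_sup_ubound _); last first.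
  by exists (osc_step L) => //=; rewrite norm2_osc_step invr_gt0 bL_gt0.
apply: Lpnorm_le => //; first exact: half_cube_diff_dom.
move=> x _; rewrite diff_op_osc normrM norm_square_wave mulr1 normrX normrN /= normr1.
by rewrite exprn_ege1// ger0_norm// ler1n.
Qed.

(** With h = b^-L, the scale t = h suffices for [q = +oo]. For finite [q], integrate over h < t < 2h
    only: the weight 1/t >= 1/(2h) compensates the length h, so the constant does not depend on
    [L]. *)
Lemma besov_osc_ge (sI : R) (p q : \bar R) : (0 < sI)%R -> 0 < p -> 0 < q ->
  exists2 K : R, (0 < K)%R & forall L : nat, (2 * (Num.truncn sI).+1 <= L)%N ->
    (K * (b%:R `^ sI) ^+ L)%:E <= besov_norm sI p q (osc b d0 L).
Proof.
move=> sI0 p0 q0.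
pose c := Lpnorm p (@half_cube R D) (cst 1%R).
have c0 : 0 < c by exact: half_cube_gt0.
have cfin : c \is a fin_num.
  rewrite ge0_fin_numE ?(ltW c0)//; apply: le_lt_trans (ltry 1).
  apply: le_trans (Lpnorm_cube_le1 (f := cst 1%R) p0 _).
    by apply: Lpnorm_le => //; exact: half_cube_sub.
  by move=> x _; rewrite normr1.
have fc0 : (0 < fine c)%R by rewrite fine_gt0// c0 ltey_eq cfin.
suff [K K0 HK] : exists2 K : R, (0 < K)%R & forall L : nat,
    (2 * (Num.truncn sI).+1 <= L)%N ->
    (K * (b%:R ^+ L) `^ sI)%:E <= besov_seminorm sI p q (osc b d0 L).
  exists K => // L hL; apply: le_trans (leeDr _ (Lpnorm_ge0 _ _ _)).
  rewrite -powR_mulrn ?powR_ge0// powRAC powR_mulrn ?ler0n//.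
  exact: HK.
case: q q0 => [q| |]//=; last first.
  move=> _; exists (fine c) => // L hL; apply: le_trans (ereal_sup_ubound _); last first.
    by exists ((b%:R ^+ L)^-1)%R => //=; rewrite invr_gt0.
  rewrite mulrC EFinM fineK// -powR_inv1 ?(ltW (bL_gt0 _))// -powRrM mulN1r opprK.
  rewrite lee_pmul// ?(ltW c0) ?lee_fin ?powR_ge0//.
  by apply: modulus_osc_ge => //; rewrite powR_inv1// ltW.
rewrite lte_fin => q0.
(* This is the q-th root of ((2h)^(-sI) c)^q / 2 with the factor h^(-sI) = b^(L sI) removed. *)
exists (2 `^ (- sI) * fine c * 2 `^ (- q^-1))%R; first by rewrite !mulr_gt0// powR_gt0.
move=> L hL; pose h : R := ((b%:R ^+ L)^-1)%R.
have h0 : (0 < h)%R by rewrite invr_gt0.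
(* The window of integration must lie inside (0, 1). *)
have h1 : (h *+ 2 <= 1)%R.
  rewrite -mulr_natr mulrC ler_pdivrMr// mul1r -natrX ler_nat.
  apply: leq_trans (ltnW (ltn_expl L b_gt1)).
  by apply: leq_trans hL; rewrite leq_pmulr.
(* A lower bound for the integrand on the whole window, taking both powers of [t] at the right end
   2h. *)
pose k := ((((h *+ 2) `^ (- sI) * fine c) `^ q) * (h *+ 2)^-1)%R.
have k0 : (0 <= k)%R by rewrite mulr_ge0 ?powR_ge0// invr_ge0 mulrn_wge0// ltW.
have -> : ((2 `^ (- sI) * fine c * 2 `^ (- q^-1) * (b%:R ^+ L) `^ sI) =
           (k * h) `^ q^-1)%R.
  have -> : (k * h = ((h *+ 2) `^ (- sI) * fine c) `^ q * 2^-1)%R.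
    by rewrite /k -mulrA -(mulr_natl h) invfM mulrAC mulfK ?gt_eqF.
  rewrite powRM ?powR_ge0 ?invr_ge0// -powRrM divff ?gt_eqF// powRr1; last first.
    by rewrite mulr_ge0 ?powR_ge0// ltW.
  rewrite -(mulr_natr h) powRM ?(ltW h0)// -(@powR_inv1 _ 2)// -powRrM mulN1r.
  rewrite /h -(@powR_inv1 _ (b%:R ^+ L)) ?(ltW (bL_gt0 _))// -powRrM mulN1r opprK.
  by rewrite mulrC !mulrA.
rewrite -poweR_EFin; apply: le_poweR; first by rewrite invr_ge0 ltW.
  by rewrite lee_fin mulr_ge0// ltW.
rewrite integral_mkcond.
apply: (@le_trans _ _ (\int[lebesgue_measure]_t (cst k%:E \_ `]h, (h *+ 2)%R[%classic) t)).
  have mh : lebesgue_measure `]h, (h *+ 2)%R[%classic = h%:E.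
    by rewrite lebesgue_measure_itv/= lte_fin mulr2n ltrDl h0 -EFinB addrK.
  by rewrite -integral_mkcond integral_cst// [X in _ <= _ * X]mh.
apply: le_integral_nonmeasurable => t _.
  by apply: erestrict_ge0 => // x _; rewrite lee_fin.
rewrite /patch; case: ifPn; last first.
  move=> _; case: ifPn => //; rewrite inE/= in_itv/= => /andP[t0 _].
  by rewrite mule_ge0 ?poweR_ge0// lee_fin invr_ge0 ltW.
rewrite inE/= in_itv/= => /andP[ht th].
have t0 : (0 < t)%R by exact: lt_trans ht.
rewrite mem_set/=; last by rewrite in_itv/= t0 (lt_le_trans th).
rewrite /k EFinM; apply: lee_pmul; rewrite ?lee_fin ?powR_ge0 ?invr_ge0 ?mulrn_wge0 ?(ltW h0)//.
  rewrite -poweR_EFin EFinM fineK//; apply: le_poweR; first exact: ltW.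
    by rewrite mule_ge0 ?(ltW c0)// lee_fin powR_ge0.
  apply: lee_pmul; rewrite ?(ltW c0) ?lee_fin ?powR_ge0//.
    rewrite !powRN lef_pV2 ?posrE ?powR_gt0 ?mulrn_wgt0//.
    by apply: ge0_ler_powR; rewrite ?nnegrE ?(ltW t0) ?mulrn_wge0 ?(ltW h0) ?(ltW sI0) ?(ltW th).
  by apply: modulus_osc_ge => //; exact: ltW.
by rewrite lef_pV2 ?posrE ?mulrn_wgt0// ltW.
Qed.
End besov.

(** * Exponential growth against powers, and the contradiction *)

(** For an integer k > a, the exponential series gives B^L >= (L ln B)^(k+1) / (k+1)!, while L^a <=
    L^k; the spare factor [L] beats the constants. *)
Lemma powR_lt_expr (R : realType) (B K C e a : R) (M : nat) :
  1 < B -> 0 < K -> 0 <= C -> 0 <= e ->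
  exists2 L : nat, (M <= L)%N & C * (L%:R * e) `^ a < K * B ^+ L.
Proof.
move=> B1 K0 C0 e0; pose k := (Num.truncn a).+1.
have lnB0 : 0 < ln B by exact: ln_gt0.
have B0 : 0 < B by exact: lt_trans B1.
pose G := K * ln B ^+ k.+1 / k.+1`!%:R.
have G0 : 0 < G by apply: divr_gt0; rewrite ?ltr0n ?fact_gt0// mulr_gt0 ?exprn_gt0.
(* The second argument ensures G L > C e^a, where [G] is the coefficient of L^(k+1). *)
pose L := maxn M.+1 (Num.truncn (C * e `^ a / G)).+1.
have L1 : (0 < L)%N by rewrite leq_max.
exists L; first by rewrite leq_max leqnSn.
have HB : B ^+ L = expR (L%:R * ln B) by rewrite mulr_natl -lnXn// lnK// posrE exprn_gt0.
apply: (@lt_le_trans _ _ (K * ((L%:R * ln B) ^+ k.+1 / k.+1`!%:R))); last first.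
  rewrite ler_pM2l// HB; apply: le_trans (expR_ge1Dxn k _).
    by rewrite lerDr.
  by rewrite mulr_ge0// ltW.
have -> : K * ((L%:R * ln B) ^+ k.+1 / k.+1`!%:R) = G * L%:R * L%:R ^+ k.
  by rewrite /G exprMn exprSr; ring.
rewrite powRM// mulrCA mulrC.
apply: (@le_lt_trans _ _ (C * e `^ a * L%:R ^+ k)).
  rewrite ler_wpM2l ?mulr_ge0 ?powR_ge0// -powR_mulrn//.
  by apply: ler_powR; [rewrite ler1n|exact/ltW/truncnS_gt].
rewrite ltr_pM2r ?exprn_gt0 ?ltr0n// [ltRHS]mulrC -ltr_pdivrMr//.
apply: lt_le_trans (truncnS_gt (C * e `^ a / G)) _.
by rewrite ler_nat leq_max leqnn orbT.
Qed.

Theorem theorem5p12 (R : realType) (b D m : nat) (hb : (2 <= b)%N)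
  (hD : (1 <= D)%N) (phi : m.+1.-tuple {poly_(m.+1) R})
  (hphi : basis_of fullv phi) (p q : \bar R) (hp : (0 < p)%E) (hq : (0 < q)%E)
  (sI s : R) (hsI : 0 < sI) (hs : 0 < s) :
  ~ continuously_embedded
      (approx_space s p q (Phi_F (D := D) b phi))
      (approx_norm s p q (Phi_F (D := D) b phi))
      (besov_space sI p q) (besov_norm sI p q).
Proof.
move=> [_ [C C0 emb]].
pose d0 := Ordinal hD.
have [K K0 besov_ge] := besov_osc_ge d0 hb hsI hp hq.
pose a := approx_exponent s q.
(* For L >= 1 the entry count L D b + D (m+1) is at most L e, a pure multiple of [L]. *)
pose e := (D * b + D * m.+1)%N.
have B1 : 1 < b%:R `^ sI.
  have b1 : 1 < b%:R :> R by rewrite ltr1n.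
  by rewrite /powR gt_eqF ?(lt_trans _ b1)// expR_gt1 mulr_gt0// ln_gt0.
have [L hL] := powR_lt_expr a (2 * (Num.truncn sI).+1) B1 K0 (ltW C0) (ler0n R e).
(* The choice of [L] is contradicted by the chain K b^(L sI) <= Besov norm <= C times approximation
   norm <= C (L e)^a. *)
rewrite ltNge => /negP; apply.
have L0 : (0 < L)%N by exact: leq_trans hL.
have e0 : (0 < e)%N by rewrite addn_gt0 !muln_gt0 hD orbT.
have osc_le1 : (Lpnorm p (@unit_cube R D) (osc b d0 L) <= 1)%E.
  by apply: Lpnorm_cube_le1 => // x _; rewrite norm_square_wave.
have osc_approx : (approx_norm s p q (Phi_F b phi) (osc b d0 L) <=
    (((L * e)%:R : R) `^ a)%:E)%E.
  apply: approx_norm_le => //; first by rewrite muln_gt0 L0.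
    by move=> n; exact: zero_Phi_F.
  move=> n hn; apply: osc_Phi_F => //; apply: leq_trans hn.
  by rewrite /e mulnDr mulnA leq_add2l mulnA leq_mul2r leq_pmull ?orbT.
rewrite -lee_fin; apply: le_trans (besov_ge L hL) _.
apply: le_trans (emb (osc b d0 L) _) _; last first.
  by rewrite -natrM EFinM lee_wpmul2l// lee_fin ltW.
split; last exact: le_lt_trans osc_approx (ltry _).
split; last exact: le_lt_trans osc_le1 (ltry _).
apply: (@measurable_funTS _ _ (D.-tuple R)).
apply: (measurableT_comp measurable_square_wave).
by apply: measurable_funM => //; exact: measurable_tnth.
Qed.
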